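(* Let $q$ be a power of a prime $p$, let $0\le j\le q-2$ and $n\ge1$ be integers, and put $k=2j+2+(n-1)(q-1)$ and $m\equiv j+1\pmod{q-1}$. Let $M,D,A,F,T$ be the $n\times n$ matrices over $\mathbb{C}_\infty$ defined in the context. If $n\le j+1$, then all of the following hold: 1. $\mathrm{Ker}(MA)\cap\mathrm{Ker}(F+MD)=\mathrm{Ker}(MA)\cap F(\mathrm{Ker}(I+MA))=0$; 2. if $q$ is odd, $MD$ is diagonalizable; if $q$ is even, $MD$ is diagonalizable if and only if $\dim_{\mathbb{C}_\infty}S^{1,new}_{k,m}(\Gamma_0(t))\le1$; 3. $S^1_{k,m}(\Gamma_0(t))=S^{1,old}_{k,m}(\Gamma_0(t))\oplus S^{1,new}_{k,m}(\Gamma_0(t))=(\mathrm{Ker}(MA)\oplus\mathrm{Ker}(MD))\oplus(\mathrm{Ker}(T)\cap F\,\mathrm{Ker}(T))$, where $S^1_{k,m}(\Gamma_0(t))$ is identified with $\mathbb{C}_\infty^n$ via the basis described in the context.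
   Context: Modular forms. $K=\mathbb{F}_q(t)$, $K_\infty$ is its completion at $\infty=1/t$, $\mathbb{C}_\infty$ is the completion of an algebraic closure of $K_\infty$, and $\Omega=\mathbb{P}^1(\mathbb{C}_\infty)-\mathbb{P}^1(K_\infty)$ is the Drinfeld upper half plane. For $\gamma=\begin{pmatrix}a&b\\c&d\end{pmatrix}\in GL_2(K_\infty)$ and $\varphi:\Omega\to\mathbb{C}_\infty$ put $(\varphi|_{k,m}\gamma)(z)=\varphi(\gamma z)(\det\gamma)^m(cz+d)^{-k}$. For $\Gamma=GL_2(\mathbb{F}_q[t])$ or $\Gamma=\Gamma_0(t)=\{\begin{pmatrix}a&b\\c&d\end{pmatrix}\in GL_2(\mathbb{F}_q[t]): c\equiv0 \bmod t\}$, $S^1_{k,m}(\Gamma)$ is the (finite dimensional) $\mathbb{C}_\infty$-space of cusp forms of weight $k$ and type $m$: rigid analytic $\varphi:\Omega\to\mathbb{C}_\infty$ with $\varphi|_{k,m}\gamma=\varphi$ for all $\gamma\in\Gamma$, holomorphic and vanishing at all cusps. It depends on $m$ only modulo $q-1$. The Atkin operator on $S^1_{k,m}(\Gamma_0(t))$ is $\mathbf{U}_t(\varphi)(z)=\sum_{b\in\mathbb{F}_q}\varphi\left(\frac{z+b}{t}\right)$; the Hecke operator on $S^1_{k,m}(GL_2(\mathbb{F}_q[t]))$ is $\mathbf{T}_t(\varphi)(z)=t^k\varphi(tz)+\sum_{b\in\mathbb{F}_q}\varphi\left(\frac{z+b}{t}\right)$ (item 1 is the matrix form of $\mathrm{Ker}(\mathbf{T}_t)=0$).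 Oldforms: let $\delta_1,\delta_t:S^1_{k,m}(GL_2(\mathbb{F}_q[t]))\to S^1_{k,m}(\Gamma_0(t))$ be $\delta_1(\varphi)=\varphi$, $\delta_t(\varphi)(z)=t^m\varphi(tz)$, and $\delta(\varphi,\psi)=\delta_1\varphi+\delta_t\psi$; then $S^{1,old}_{k,m}(\Gamma_0(t))=\mathrm{Im}(\delta)$. Newforms: let $\varphi^{Fr}=\varphi|_{k,m}\begin{pmatrix}0&-1\\t&0\end{pmatrix}$ (Fricke involution), $Tr(\varphi)=\sum_{\gamma\in R}\varphi|_{k,m}\gamma$ with $R=\{\mathrm{Id}\}\cup\{\begin{pmatrix}0&-1\\1&b\end{pmatrix}:b\in\mathbb{F}_q\}$, and $Tr'(\varphi)=Tr(\varphi^{Fr})$; then $S^{1,new}_{k,m}(\Gamma_0(t))=\mathrm{Ker}(Tr)\cap\mathrm{Ker}(Tr')$. Basis. Let $\Gamma_1(t)\subset\Gamma_0(t)$ be the subgroup with diagonal entries $\equiv1 \bmod t$. Teitelbaum's residue isomorphism identifies $S^1_{k,m}(\Gamma_1(t))$ with the harmonic cocycles of weight $k$ for $\Gamma_1(t)$: functions $\mathbf{c}$ from oriented edges of the Bruhat-Tits tree of $GL_2(K_\infty)$ (edges $=GL_2(K_\infty)/Z(K_\infty)\mathcal{I}(K_\infty)$, with $\mathcal{I}$ the Iwahori subgroup) to the dual of $V=\bigoplus_{i=0}^{k-2}\mathbb{C}_\infty X^iY^{k-2-i}$ which are harmonic, antisymmetric under edge reversal, and $\Gamma_1(t)$-equivariant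 for the action $(\gamma\omega)(X^iY^{k-2-i})=\det(\gamma)^{1-m}\omega((aX+bY)^i(cX+dY)^{k-2-i})$. Such a cocycle is determined by its value on the edge $\bar e$ represented by $\begin{pmatrix}0&1\\1&0\end{pmatrix}$, and a basis is $\mathbf{c}_0,\dots,\mathbf{c}_{k-2}$ where $\mathbf{c}_i(\bar e)(X^lY^{k-2-l})=1$ if $l=i$ and $0$ otherwise. For $k,j,n,m$ as in the claim, $S^1_{k,m}(\Gamma_0(t))$ has basis $\mathbf{c}_{j+(b-1)(q-1)}$, $1\le b\le n$. Matrices (size $n\times n$). $M=(m_{a,b})$ has entries in $\mathbb{F}_p$: $$m_{a,b}=-\left[\binom{j+(n-a)(q-1)}{j+(n-b)(q-1)}+(-1)^{j+1}\binom{j+(n-a)(q-1)}{j+(b-1)(q-1)}\right]\ (a\ne b),\qquad m_{a,a}=(-1)^j\binom{j+(n-a)(q-1)}{j+(a-1)(q-1)},$$ with $\binom{x}{y}=0$ if $y>x$. With $s_i=j+1+(i-1)(q-1)$: $D=\mathrm{diag}(t^{s_1},\dots,t^{s_n})$; $F$ is the antidiagonal matrix whose entry in row $n+1-b$, column $b$ is $(-t)^{s_b}$; $A$ is the antidiagonal matrix with all antidiagonal entries $(-1)^{j+1}$; $I$ is the identity; $T=I+MA$. In the basis $\mathbf{c}_{j+(b-1)(q-1)}$, $1\le b\le n$, of $S^1_{k,m}(\Gamma_0(t))$ (column convention), $\mathbf{U}_t$ has matrix $MD$, the Fricke involution has matrix $t^{m-k}F$, $Tr$ has matrix $T$, and $Tr'$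 has matrix $t^{m-k}(F+MD)$; moreover $\mathrm{Im}(\delta_1)=\mathrm{Ker}(MA)$, $\mathrm{Im}(\delta_t)=\mathrm{Ker}(MD)$ and newforms are $\mathrm{Ker}(T)\cap F(\mathrm{Ker}(T))$. *)

(* Defs.v *)
From HB Require Import structures.
From mathcomp Require Import all_boot all_order all_algebra.
From mathcomp Require Import all_classical all_reals all_analysis.
Set Implicit Arguments.
Unset Strict Implicit.
Unset Printing Implicit Defensive.
Import Order.TTheory GRing.Theory Num.Theory.
Import numFieldNormedType.Exports.
Local Open Scope classical_set_scope.
Local Open Scope ring_scope.

(* The field C_oo over K = F_q(t), axiomatised by its characterisation: an
   algebraically closed field, complete for a non-archimedean absolute value
   that extends the one of K at oo = 1/t (normalised by |t| = q), in which the
   elements algebraic over K_oo are dense.  K_oo itself is the closure of K. *)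
Record Cinfty (F : finFieldType) (R : realType) := MkCinfty {
  Cfield :> closedFieldType;
  abs : Cfield -> R;
  iota : {rmorphism {fraction {poly F}} -> Cfield};
  abs_ge0 : forall x, 0 <= abs x;
  abs_eq0 : forall x, abs x = 0 <-> x = 0;
  absM : forall x y, abs (x * y) = abs x * abs y;
  abs_ultra : forall x y, abs (x + y) <= Num.max (abs x) (abs y);
  abs_poly : forall a : {poly F}, a != 0 ->
    abs (iota (tofrac a)) = #|F|%:R ^+ (size a).-1;
  abs_complete : forall u : nat -> Cfield,
    (forall eps : R, 0 < eps -> exists N : nat, forall i j : nat,
       (N <= i)%N -> (N <= j)%N -> abs (u i - u j) < eps) ->
    exists l, (fun n => abs (u n - l)) @ \oo --> (0 : R);
  alg_dense : forall (x : Cfield) (eps : R), 0 < eps ->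
    exists2 y : Cfield, abs (x - y) < eps &
    exists P : {poly Cfield}, [/\ P != 0, root P y &
      forall (i : nat) (del : R), 0 < del ->
        exists a : {fraction {poly F}}, abs (P`_i - iota a) < del]
}.
Arguments abs {F R} _ _.
Arguments iota {F R} _.

Definition emb F R (K : Cinfty F R) (a : {poly F}) : K := iota K (tofrac a).

Definition tC F R (K : Cinfty F R) : K := emb K 'X.

Definition cvgto F R (K : Cinfty F R) (u : nat -> K) (l : K) : Prop :=
  (fun n => abs K (u n - l)) @ \oo --> (0 : R).

Definition sums_to F R (K : Cinfty F R) (u : nat -> K) (l : K) : Prop :=
  cvgto (fun n => \sum_(i < n) u i) l.

Definition Kinfty F R (K : Cinfty F R) : set K :=
  [set x | forall eps : R, 0 < eps ->
     exists a : {fraction {poly F}}, abs K (x - iota K a) < eps].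

(* oo lies in P^1(K_oo), so Omega is a subset of the affine line. *)
Definition Omega F R (K : Cinfty F R) : set K := ~` @Kinfty F R K.

Arguments Kinfty {F R} K.
Arguments Omega {F R} K.

(* The standard exhaustion of Omega by the connected affinoids
   |z| <= q^N, |z - x| >= q^-N for all x in K_oo. *)
Definition affinoid F R (K : Cinfty F R) (N : nat) : set K :=
  [set z | abs K z <= #|F|%:R ^+ N /\
           forall x, Kinfty K x -> #|F|%:R ^- N <= abs K (z - x)].
Arguments affinoid {F R} K N.

(* On each affinoid, a uniform limit of rational functions without poles. *)
Definition rigid_analytic F R (K : Cinfty F R) (f : K -> K) : Prop :=
  forall (N : nat) (eps : R), 0 < eps -> exists P Q : {poly K},
  forall z, affinoid K N z -> Q.[z] != 0 /\ abs K (f z - P.[z] / Q.[z]) <= eps.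

Definition mx2 (T : Type) (a b c d : T) : 'M[T]_2 :=
  \matrix_(r < 2, s < 2)
    if r == 0 then (if s == 0 then a else b) else (if s == 0 then c else d).

(* Functions on Omega are represented by functions on C_oo that vanish off
   Omega (see [cusp_form]).  The group GL_2(K_oo) preserves K_oo u {oo}, and 0
   is in K_oo, so this convention is stable under all the operators below,
   including at the points where c z + d = 0. *)
Definition slash F R (K : Cinfty F R) (k : nat) (m : int) (g : 'M[K]_2)
    (phi : K -> K) : K -> K :=
  fun z => phi ((g 0 0 * z + g 0 1) / (g 1 0 * z + g 1 1))
           * (\det g) ^ m * (g 1 0 * z + g 1 1) ^- k.

Definition GL2A (F : finFieldType) : set 'M[{poly F}]_2 :=
  [set g | g \in unitmx].

Definition Gamma0t (F : finFieldType) : set 'M[{poly F}]_2 :=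
  [set g | g \in unitmx /\ ('X %| g 1 0)%R].

(* The exponential of the lattice t F_q[t] : e(z) = z * prod (1 - z / l) over
   the nonzero l in t F_q[t], as the limit of the products over the
   l = t * a with deg a < d. *)
Definition lattice_exp F R (K : Cinfty F R) (z e : K) : Prop :=
  cvgto (fun d => z * \prod_(v : 'rV[F]_d | v != 0)
                        (1 - z / (tC K * emb K (rVpoly v)))) e.

(* f is holomorphic and vanishes at oo: for |z|_i := inf_(x in K_oo) |z - x|
   large, f is a power series without constant term in the uniformizer
   u = 1/e(z).  All the functions phi|g with phi of level Gamma_0(t) or
   GL_2(F_q[t]) and g in GL_2(F_q[t]) are invariant under translations by
   t F_q[t], so the same uniformizer serves at all cusps. *)
Definition vanishes_at_oo F R (K : Cinfty F R) (f : K -> K) : Prop :=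
  exists (a : nat -> K) (r : R), a 0%N = 0 /\
  forall z, Omega K z -> (forall x, Kinfty K x -> r <= abs K (z - x)) ->
  exists2 e : K, lattice_exp z e & sums_to (fun i => a i * e ^- i) (f z).

(* S^1_{k,m}(G) for G = GL_2(F_q[t]) or Gamma_0(t).  Every cusp is of the form
   g(oo) with g in GL_2(F_q[t]). *)
Definition cusp_form F R (K : Cinfty F R) (k : nat) (m : int)
    (G : set 'M[{poly F}]_2) : set (K -> K) :=
  [set phi |
    [/\ forall z, ~ Omega K z -> phi z = 0,
        rigid_analytic phi,
        forall g, G g -> slash k m (map_mx (emb K) g) phi = phi &
        forall g, GL2A g ->
          vanishes_at_oo (slash k m (map_mx (emb K) g) phi)]].
Arguments cusp_form {F R} K k m G.

Definition delta_t F R (K : Cinfty F R) (m : int) (phi : K -> K) : K -> K :=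
  fun z => tC K ^ m * phi (tC K * z).

Definition oldforms F R (K : Cinfty F R) (k : nat) (m : int) : set (K -> K) :=
  [set f | exists phi psi : K -> K,
     [/\ cusp_form K k m (@GL2A F) phi, cusp_form K k m (@GL2A F) psi &
         f = (fun z => phi z + delta_t m psi z)]].
Arguments oldforms {F R} K k m.

Definition fricke F R (K : Cinfty F R) (k : nat) (m : int) (phi : K -> K) :
    K -> K :=
  slash k m (mx2 0 (-1) (tC K) 0) phi.

Definition Tr F R (K : Cinfty F R) (k : nat) (m : int) (phi : K -> K) :
    K -> K :=
  fun z => slash k m 1%:M phi z
           + \sum_(b : F) slash k m (mx2 0 (-1) 1 (emb K b%:P)) phi z.

Definition Tr' F R (K : Cinfty F R) (k : nat) (m : int) (phi : K -> K) :
    K -> K :=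
  Tr k m (fricke k m phi).

Definition newforms F R (K : Cinfty F R) (k : nat) (m : int) : set (K -> K) :=
  [set f | [/\ cusp_form K k m (@Gamma0t F) f,
               Tr k m f = (fun=> 0) & Tr' k m f = (fun=> 0)]].
Arguments newforms {F R} K k m.

Definition lincomb (C : fieldType) (d : nat) (c : 'I_d -> C -> C)
    (v : 'cV[C]_d) : C -> C :=
  fun z => \sum_(i < d) v i 0 * c i z.

Definition is_basis (C : fieldType) (d : nat) (W : set (C -> C))
    (c : 'I_d -> C -> C) : Prop :=
  (forall f, W f <-> exists v, f = lincomb c v) /\ injective (lincomb c).

Definition has_dim (C : fieldType) (W : set (C -> C)) (d : nat) : Prop :=
  exists c : 'I_d -> C -> C, is_basis W c.

Definition is_direct_sum (C : fieldType) (W U V : set (C -> C)) : Prop :=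
  W = [set f | exists g h, [/\ U g, V h & f = (fun z => g z + h z)]] /\
  U `&` V = [set (fun=> 0)].

(* The edge ebar = [0 1; 1 0] joins the vertices of Id and diag(1, t), and
   corresponds to the annulus q^-1 < |z| < 1.  The Laurent expansion there is
   f(z) = sum_(i in Z) a_i z^i; both halves are required to converge. *)
Definition laurent_ebar F R (K : Cinfty F R) (f : K -> K) (a : int -> K) :
    Prop :=
  forall z, #|F|%:R^-1 < abs K z -> abs K z < 1 ->
  exists l1 l2 : K,
    [/\ sums_to (fun i => a i%:Z * z ^+ i) l1,
        sums_to (fun i => a (- i.+1%:Z) * z ^- i.+1) l2 & f z = l1 + l2].

(* The value at ebar of the harmonic cocycle attached to f by Teitelbaum's
   residue map: X^l Y^(k-2-l) is sent to the residue w l of z^l f(z) dz on the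
   annulus of ebar, i.e. the Laurent coefficient of index -1-l.  (The opposite
   orientation would change the sign of all the residues, which does not
   affect the matrix of any operator.) *)
Definition residue_ebar F R (K : Cinfty F R) (k : nat) (f : K -> K)
    (w : nat -> K) : Prop :=
  exists2 a : int -> K, laurent_ebar f a &
  forall l, (l <= k - 2)%N -> w l = a (- l.+1%:Z).

(* The basis c_(j+(b-1)(q-1)), 1 <= b <= n, of S^1_{k,m}(Gamma_0(t)); here and
   below the indices in 'I_n are b - 1. *)
Definition cocycle_basis F R (K : Cinfty F R) (j n k : nat) (m : int)
    (c : 'I_n -> K -> K) : Prop :=
  is_basis (cusp_form K k m (@Gamma0t F)) c /\
  forall b : 'I_n,
    residue_ebar k (c b) (fun l => (l == (j + b * (#|F| - 1))%N)%:R).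

(* L acts on S^1_{k,m}(Gamma_0(t)) by the matrix X in the basis c. *)
Definition has_matrix (C : fieldType) (n : nat) (c : 'I_n -> C -> C)
    (L : (C -> C) -> C -> C) (X : 'M[C]_n) : Prop :=
  forall v : 'cV[C]_n, L (lincomb c v) = lincomb c (X *m v).

(* The 1-based n - a and b - 1 are n - a.+1 and b for 0-based indices. *)
Definition matM (C : fieldType) (q j n : nat) : 'M[C]_n :=
  \matrix_(a < n, b < n)
    if a == b then
      (-1) ^+ j * 'C(j + (n - a.+1) * (q - 1), j + a * (q - 1))%:R
    else
      - ('C(j + (n - a.+1) * (q - 1), j + (n - b.+1) * (q - 1))%:R
         + (-1) ^+ j.+1 * 'C(j + (n - a.+1) * (q - 1), j + b * (q - 1))%:R).

Definition s_exp (q j b : nat) : nat := (j + 1 + b * (q - 1))%N.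

Definition matD (C : fieldType) (t : C) (q j n : nat) : 'M[C]_n :=
  diag_mx (\row_(b < n) t ^+ s_exp q j b).

Definition matF (C : fieldType) (t : C) (q j n : nat) : 'M[C]_n :=
  \matrix_(a < n, b < n) if a == rev_ord b then (- t) ^+ s_exp q j b else 0.

Definition matA (C : fieldType) (j n : nat) : 'M[C]_n :=
  \matrix_(a < n, b < n) if a == rev_ord b then (-1) ^+ j.+1 else 0.

Definition matT (C : fieldType) (q j n : nat) : 'M[C]_n :=
  1%:M + matM C q j n *m matA C j n.

(* Kernels and images for matrices acting on column vectors. *)
Definition Ker (C : fieldType) (n : nat) (X : 'M[C]_n) : {vspace 'cV[C]_n} :=
  lker (linfun (mulmx X)).

Definition Img (C : fieldType) (n : nat) (X : 'M[C]_n)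
    (U : {vspace 'cV[C]_n}) : {vspace 'cV[C]_n} :=
  (linfun (mulmx X) @: U)%VS.

(* Main.v *)
(** For [n <= j + 1], Lucas' theorem kills every binomial in [M] except those
    equal to 1, so [M] is [(-1)^j] times the antidiagonal permutation matrix.
    Hence [M A = -1] and [T = 0]: every form is new. On forms of level one [Tr]
    is multiplication by [q + 1 = 1], so [T = 0] also forces the old space to
    vanish. Finally [(M D)^2 = t^k] is scalar, with nonzero square roots [r]
    and [-r]: for [q] odd [M D] is diagonalizable because [r <> -r], and for
    [q] even it is diagonalizable only if it equals [r], that is, if [n = 1]. *)

Require Import Defs.
From HB Require Import structures.
From mathcomp Require Import all_boot all_order all_algebra.
From mathcomp Require Import all_classical all_reals all_analysis.
From mathcomp Require Import finfield zify.
Set Implicit Arguments.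
Unset Strict Implicit.
Unset Printing Implicit Defensive.
Import Order.TTheory GRing.Theory Num.Theory.
Local Open Scope classical_set_scope.
Local Open Scope ring_scope.

(** * Products and inverses of antidiagonal matrices *)

Section Antidiagonal.
Variables (C : fieldType) (n : nat).

(** Entries are indexed by their column, so that [matA] and [matF] are instances by conversion. *)
Definition antidiag_mx (x : 'I_n -> C) : 'M[C]_n :=
  \matrix_(a, b) if a == rev_ord b then x b else 0.

Lemma mul_antidiag (x y : 'I_n -> C) :
  antidiag_mx x *m antidiag_mx y = diag_mx (\row_b (x (rev_ord b) * y b)).
Proof.
apply/matrixP => a b; rewrite !mxE (bigD1 (rev_ord b)) //= !mxE eqxx rev_ordK.
rewrite big1 ?addr0 => [|u /negPf ub]; last by rewrite !mxE ub mulr0.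
by case: eqVneq => [->|_]; rewrite ?mulr1n ?mulr0n ?mul0r.
Qed.

Lemma unitmx_antidiag (x : 'I_n -> C) : (forall b, x b != 0) ->
  antidiag_mx x \in unitmx.
Proof.
move=> x0; pose y b := (x (rev_ord b))^-1.
have /mulmx1_unit[] // : antidiag_mx x *m antidiag_mx y = 1%:M.
rewrite mul_antidiag -diag_const_mx; congr diag_mx.
by apply/rowP => b; rewrite !mxE mulfV.
Qed.

End Antidiagonal.

(** * Binomial coefficients modulo [p] and the shape of [M] *)

Section BinomialsModP.
Variables (C : fieldType) (p e : nat).
Hypothesis pC : p \in [pchar C].
Local Notation q := (p ^ e)%N.

Lemma coef_1DX_exp (n i : nat) : ((1 + 'X) ^+ n : {poly C})`_i = 'C(n, i)%:R.
Proof.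
rewrite exprDn coef_sum; under eq_bigr do rewrite expr1n mul1r coefMn coefXn.
have [lein|ltni] := leqP i n; last first.
  rewrite bin_small// big1// => u _.
  by rewrite gtn_eqF ?mul0rn// (leq_trans (ltn_ord u)).
rewrite (bigD1 (inord i)) //= inordK// eqxx big1 ?addr0// => u ui.
rewrite (_ : (i == u) = false) ?mul0rn//; apply: contraNF ui => /eqP ->.
by rewrite inord_val.
Qed.

(* Compare coefficients in (1 + X)^(N + q) = (1 + X)^N (1 + X^q). *)
Lemma bin_addq (N M : nat) :
  'C(N + q, M)%:R = 'C(N, M)%:R + (if (M < q)%N then 0 else 'C(N, M - q)%:R) :> C.
Proof.
rewrite -!coef_1DX_exp exprD (@exprDn_pchar _ _ _ q); last first.
  by rewrite pnatX pnatE ?(pcharf_prime pC)// pchar_poly pC.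
by rewrite expr1n mulrDr mulr1 coefD coefMXn.
Qed.

(** Induction on the leading digit [i], with [bin_addq] giving Pascal's rule for that digit. *)
Lemma bin_lucas (i l r s : nat) : (r < q)%N -> (s < q)%N ->
  'C(i * q + r, l * q + s)%:R = 'C(i, l)%:R * 'C(r, s)%:R :> C.
Proof.
move=> rq sq; elim: i l => [|i IH] [|l].
- by rewrite !mul0n bin0 mul1r.
- by rewrite bin0n mul0r bin_small// mul0n mulSn; lia.
- by rewrite mulSn -addnA addnC bin_addq mul0n sq addr0 (IH 0) !bin0.
rewrite mulSn -addnA addnC bin_addq IH mulSn ifF; last by lia.
by rewrite -addnA addKn IH binS natrD mulrDl.
Qed.

(* [j + i (q - 1)] has base [q] digits [i] and [j - i]; the binomials [C(i, l)]
   and [C(j - i, j - l)] are both nonzero only for [i = l]. *)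
Lemma bin_j_add_mulq1 (j i l : nat) : (j < q)%N -> (i <= j)%N -> (l <= j)%N ->
  'C(j + i * (q - 1), j + l * (q - 1))%:R = (i == l)%:R :> C.
Proof.
move=> jq ij lj.
have digits u : (u <= j -> j + u * (q - 1) = u * q + (j - u))%N.
  by move=> uj; rewrite mulnBr muln1; nia.
rewrite !digits// bin_lucas; [|lia|lia].
have [->|] := eqVneq i l; first by rewrite !binn mulr1.
rewrite neq_ltn => /orP[il|li]; first by rewrite bin_small// mul0r.
by rewrite (@bin_small (j - i)) ?mulr0//; lia.
Qed.

(** As [n <= j + 1], all multipliers of [q - 1] are at most [j], so every binomial is a Kronecker
    delta. Off the diagonal the first one vanishes and the second selects [a = rev_ord b]; on the
    diagonal only the middle index of an odd [n] survives, which also lies on the antidiagonal. *)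
Lemma matM_antidiag (j n : nat) : (j < q)%N -> (n <= j + 1)%N ->
  matM C q j n = antidiag_mx (fun=> (-1) ^+ j).
Proof.
move=> jq nj; apply/matrixP => a b; rewrite !mxE.
have [an bn] := (ltn_ord a, ltn_ord b).
have rev_ordE : (n - a.+1 == b)%N = (a == rev_ord b).
  by rewrite -val_eqE /=; lia.
rewrite !bin_j_add_mulq1 ?rev_ordE//; try lia.
have [<-|ab] := eqVneq a b.
  rewrite (_ : (n - a.+1 == a)%N = (a == rev_ord a)).
    by case: ifP; rewrite ?mulr1 ?mulr0.
  by rewrite -val_eqE /=; lia.
rewrite (_ : (n - a.+1 == n - b.+1)%N = false) ?add0r; last first.
  by move: ab; rewrite -val_eqE /=; lia.
by case: ifP; rewrite ?mulr0 ?oppr0// mulr1 exprS mulN1r opprK.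
Qed.

End BinomialsModP.

(** * Diagonalizability of square roots of a scalar matrix *)

Lemma diagonalizable_leq1 (C : fieldType) n (B : 'M[C]_n) :
  (n <= 1)%N -> diagonalizable B.
Proof.
case: n B => [|[|//]] B _; first by rewrite flatmx0; exact: diagonalizable0.
by rewrite [B]mx11_scalar; exact: diagonalizable_scalar.
Qed.

Section SquareScalar.
Variables (C : fieldType) (r : C).

(** The polynomial [(X - r)(X + r)] annihilates [B] and has simple roots, and the minimal polynomial
    divides it. *)
Lemma diagonalizable_of_sqr n (B : 'M[C]_n.+1) :
  B *m B = (r ^+ 2)%:M -> r != - r -> diagonalizable B.
Proof.
move=> BB rNr; apply/diagonalizableP; exists [:: r; - r].
  by rewrite /= inE rNr.
apply: mxminpoly_min; rewrite !big_cons big_nil mulr1 polyCN opprK.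
rewrite -subr_sqr -polyC_exp rmorphB rmorphXn /=.
by rewrite horner_mx_X horner_mx_C expr2 -mulmxE BB subrr.
Qed.

(** Each eigenvalue [d] satisfies [d^2 = r^2], that is [(d - r)^2 = 0] by additivity of the
    Frobenius. The diagonal form is thus the scalar [r], which conjugation fixes. *)
Lemma diagonalizable_sqr_pchar2 n (B : 'M[C]_n) : 2%N \in [pchar C] ->
  B *m B = (r ^+ 2)%:M -> diagonalizable B -> B = r%:M.
Proof.
move=> C2 BB [P Pu /diagonalizable_forPex[d /(simmxP Pu) PBd]].
suff -> : B = invmx P *m (r%:M *m P) by rewrite -scalar_mxC mulmxA mulVmx// mul1mx.
rewrite -[B in LHS](mulKmx Pu) PBd; congr (_ *m (_ *m _)).
have : diag_mx d *m diag_mx d = (r ^+ 2)%:M.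
  by rewrite -[LHS](mulmxK Pu) -(mulmxA _ _ P) -PBd mulmxA -PBd -(mulmxA P) BB
             scalar_mxC -mulmxA mulmxV// mulmx1.
rewrite mulmx_diag -!diag_const_mx => dd; congr diag_mx; apply/rowP => i.
move/matrixP/(_ i i): dd; rewrite !mxE eqxx !mulr1n -expr2 => /eqP.
by rewrite -subr_eq0 -(pFrobenius_autE C2) -(pFrobenius_autE C2) -pFrobenius_autB_comm;
  [rewrite pFrobenius_autE expf_eq0 /= subr_eq0 => /eqP| exact: mulrC].
Qed.

End SquareScalar.

(** * Kernels and images of invertible and zero matrices *)

Section KernelsAndImages.
Variables (C : fieldType) (n : nat).

Lemma Ker_unitmx (X : 'M[C]_n) : X \in unitmx -> Ker X = 0%VS.
Proof.
move=> Xu; apply/eqP/lker0P => u v; rewrite !lfunE /= => Xuv.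
by rewrite -(mulKmx Xu u) Xuv mulKmx.
Qed.

Lemma Ker0 : Ker (0 : 'M[C]_n) = fullv.
Proof.
apply/eqP; rewrite eqEsubv subvf; apply/subvP => v _.
by rewrite memv_ker lfunE /= mul0mx.
Qed.

Lemma Img_unitmx_fullv (X : 'M[C]_n) : X \in unitmx -> Img X fullv = fullv.
Proof.
move=> Xu; apply/eqP; rewrite eqEsubv subvf; apply/subvP => v _.
by apply/memv_imgP; exists (invmx X *m v); rewrite ?memvf// lfunE /= mulKVmx.
Qed.

End KernelsAndImages.

(** * Coordinates and dimension in spaces of functions *)

Section Lincomb.
Variable C : fieldType.

Lemma lincomb0 d (c : 'I_d -> C -> C) : lincomb c 0 = (fun=> 0).
Proof. by apply/funext => z; rewrite /lincomb big1// => i _; rewrite mxE mul0r. Qed.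

Lemma lincomb_delta d (c : 'I_d -> C -> C) i : lincomb c (delta_mx i 0) = c i.
Proof.
apply/funext => z; rewrite /lincomb (bigD1 i) //= !mxE !eqxx mul1r big1 ?addr0//.
by move=> u /negPf ui; rewrite !mxE ui mul0r.
Qed.

(** The coordinates of [c] in [c'] form a [d] by [d'] matrix; injectivity of [lincomb c] makes its
    rows independent, so its rank is [d]. *)
Lemma is_basis_leq (W : set (C -> C)) d d' (c : 'I_d -> C -> C)
    (c' : 'I_d' -> C -> C) : is_basis W c -> is_basis W c' -> (d <= d')%N.
Proof.
move=> [Wc cI] [Wc' _].
have /(_ _)/cid coord i : exists v, c i = lincomb c' v.
  by apply/Wc'/Wc; exists (delta_mx i 0); rewrite lincomb_delta.
pose X : 'M[C]_(d, d') := \matrix_(i, l) projT1 (coord i) l 0.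
have lincombX v : lincomb c v = lincomb c' (v^T *m X)^T.
  apply/funext => z; rewrite /lincomb.
  under eq_bigr => i _ do rewrite (projT2 (coord i)) /lincomb mulr_sumr.
  rewrite exchange_big; apply: eq_bigr => l _.
  by rewrite !mxE mulr_suml; apply: eq_bigr => i _; rewrite !mxE mulrA.
suff <- : \rank X = d by exact: rank_leq_col.
apply/eqP; apply: inj_row_free => v vX0.
apply: trmx_inj; rewrite trmx0; apply: cI.
by rewrite lincombX trmxK vX0 trmx0 !lincomb0.
Qed.

End Lincomb.

(** * Traces of level one forms and vanishing of oldforms *)

Section CuspForms.
Variables (F : finFieldType) (R : realType) (K : Cinfty F R) (k : nat) (m : int).

Lemma slash_fun0 g : @slash F R K k m g (fun=> 0) = (fun=> 0).
Proof. by apply/funext => z; rewrite /slash !mul0r. Qed.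

Lemma tC_neq0 : tC K != 0.
Proof. by rewrite fmorph_eq0 tofrac_eq0 polyX_eq0. Qed.

Lemma pchar_Cinfty p : p \in [pchar F] -> p \in [pchar K].
Proof.
rewrite -pchar_poly => /(rmorph_pchar (@tofrac {poly F})) pFt.
by rewrite (fmorph_pchar (Defs.iota K)).
Qed.

Lemma cusp_form_GL2A_Gamma0t phi :
  cusp_form K k m (@GL2A F) phi -> cusp_form K k m (@Gamma0t F) phi.
Proof. by case=> [? ? inv ?]; split=> // g [/inv]. Qed.

(** All [q + 1] coset representatives lie in [GL_2(F_q[t])] and fix [phi], so the trace is
    [(q + 1) phi = phi]. *)
Lemma Tr_GL2A phi : #|F|%:R = 0 :> K ->
  cusp_form K k m (@GL2A F) phi -> Tr k m phi = phi.
Proof.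
move=> q0 [_ _ inv _].
have slash1 : slash k m 1%:M phi = phi.
  rewrite -[RHS](inv 1%:M); last exact: unitmx1.
  congr slash; apply/matrixP => a b; rewrite !mxE /emb.
  by case: (a == b); rewrite /= ?rmorph1 ?rmorph0.
have slashR (b : F) : slash k m (mx2 0 (-1) 1 (emb K b%:P)) phi = phi.
  rewrite -[RHS](inv (mx2 0 (-1) 1 b%:P)).
    congr slash; apply/matrixP => a a'; rewrite !mxE /emb.
    by do 2 case: ifP => _; rewrite ?rmorph0 ?rmorph1 ?rmorphN1.
  (* The representative has determinant 1. *)
  rewrite /GL2A /= unitmxE (expand_det_row _ 0) !big_ord_recl big_ord0 !mxE /=.
  rewrite /cofactor !det_mx11 !mxE /= mul0r add0r addr0 addn1 expr1 mulr1 mulrNN.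
  by rewrite mulr1 unitr1.
apply/funext => z; rewrite /Tr slash1; under eq_bigr do rewrite slashR.
by rewrite sumr_const cardT -cardE -mulr_natr q0 mulr0 addr0.
Qed.

(* [vanishes_at_oo] of the zero function still asserts that the lattice
   exponential converges; this is read off from the zero form being of level [t]. *)
Lemma cusp_form_GL2A_fun0 d (c : 'I_d -> K -> K) :
  is_basis (cusp_form K k m (@Gamma0t F)) c -> cusp_form K k m (@GL2A F) (fun=> 0).
Proof.
move=> [Wc _]; have /Wc[] : exists v, (fun=> 0) = lincomb c v.
  by exists 0; rewrite lincomb0.
by move=> ? ? _ ?; split=> // g _; rewrite slash_fun0.
Qed.

(** A form of level one is its own trace, hence zero, and both summands of an oldform come from
    level one. *)
Lemma oldforms_fun0 d (c : 'I_d -> K -> K) :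
    #|F|%:R = 0 :> K -> is_basis (cusp_form K k m (@Gamma0t F)) c ->
    (forall f, cusp_form K k m (@Gamma0t F) f -> Tr k m f = (fun=> 0)) ->
  oldforms K k m = [set (fun=> 0)].
Proof.
move=> q0 cb Tr0.
have level1 phi : cusp_form K k m (@GL2A F) phi -> phi = (fun=> 0).
  by move=> phiG; rewrite -(Tr_GL2A q0 phiG) Tr0//; exact: cusp_form_GL2A_Gamma0t.
have zz : (fun z => 0 + delta_t m (fun=> 0) z) = (fun=> 0) :> (K -> K).
  by apply/funext => z; rewrite /delta_t mulr0 addr0.
apply/seteqP; split=> [f [phi [psi [/level1-> /level1-> ->]]] //|f /= ->].
by exists (fun=> 0), (fun=> 0); split=> //; exact: cusp_form_GL2A_fun0 cb.
Qed.

End CuspForms.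

(** * Old and new spaces, and diagonalizability of [M D] *)

Theorem theorem5p8 (p e q : nat) (hp : prime p) (he : (0 < e)%N)
    (hq : q = (p ^ e)%N) (F : finFieldType) (hF : #|F| = q)
    (R : realType) (K : Cinfty F R)
    (j n k : nat) (m : int)
    (hj : (j <= q - 2)%N) (hn : (1 <= n)%N)
    (hk : k = (2 * j + 2 + (n - 1) * (q - 1))%N)
    (hm : (m = (j + 1)%N%:Z %[mod (q - 1)%N%:Z])%Z)
    (c : 'I_n -> K -> K)
    (hc : cocycle_basis j k m c)
    (hFr : has_matrix c (fricke k m) (tC K ^ (m - k%:Z) *: matF (tC K) q j n))
    (hTr : has_matrix c (Tr k m) (matT K q j n))
    (hnj : (n <= j + 1)%N) :
  let M := matM K q j n in
  let D := matD (tC K) q j n in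
  let A := matA K j n in
  let Fm := matF (tC K) q j n in
  let T := matT K q j n in
  let old := (Ker (M *m A) + Ker (M *m D))%VS in
  let new := (Ker T :&: Img Fm (Ker T))%VS in
  [/\ (Ker (M *m A) :&: Ker (Fm + M *m D)
         = Ker (M *m A) :&: Img Fm (Ker (1%:M + M *m A)))%VS
      /\ (Ker (M *m A) :&: Img Fm (Ker (1%:M + M *m A)) = 0)%VS,
      (odd q -> diagonalizable (M *m D)) /\
      (~~ odd q -> (diagonalizable (M *m D) <->
         exists d, has_dim (newforms K k m) d /\ (d <= 1)%N)) &
      [/\ is_direct_sum (cusp_form K k m (@Gamma0t F))
            (oldforms K k m) (newforms K k m),
          forall v, oldforms K k m (lincomb c v) <-> v \in old,
          forall v, newforms K k m (lincomb c v) <-> v \in new,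
          (old + new = fullv)%VS &
          directv (Ker (M *m A) + Ker (M *m D) + new)]].
Proof.
move=> M D A Fm T old new.
have pF : p \in [pchar F] by apply: (@card_finPcharP _ p e); rewrite ?hF.
have pK := pchar_Cinfty K pF.
have q0 : #|F|%:R = 0 :> K by rewrite hF hq natrX (pcharf0 pK) expr0n gtn_eqF.
have q2 : (1 < q)%N by rewrite hq -(exp1n e) ltn_exp2r ?prime_gt1.
have t0 := tC_neq0 K.
have ME : M = antidiag_mx (fun=> (-1) ^+ j).
  by rewrite /M hq; apply: matM_antidiag => //; rewrite -hq; lia.
have AE : A = antidiag_mx (fun=> (-1) ^+ j.+1) by [].
have MAE : M *m A = - 1%:M.
  rewrite ME AE mul_antidiag -diag_const_mx -raddfN; congr diag_mx.
  by apply/rowP => b; rewrite !mxE exprS mulrCA -expr2 sqrr_sign mulr1.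
have T0 : T = 0 by rewrite /T /matT -/M -/A MAE subrr.
have MDE : M *m D = antidiag_mx (fun b => (-1) ^+ j * tC K ^+ s_exp q j b).
  rewrite ME mul_mx_diag; apply/matrixP => a b; rewrite !mxE.
  by case: ifP; rewrite ?mul0r.
have signX0 (i : nat) : (-1) ^+ i != 0 :> K by rewrite signr_eq0.
have MDu : M *m D \in unitmx.
  by rewrite MDE; apply: unitmx_antidiag => b; rewrite mulf_neq0 ?signX0 ?expf_neq0.
have MAu : M *m A \in unitmx by rewrite MAE -scaleN1r unitmxZ ?unitrN1 ?unitmx1.
have Fu : Fm \in unitmx.
  by apply: unitmx_antidiag => b; rewrite expf_neq0 ?oppr_eq0.
have KMA := Ker_unitmx MAu; have KMD := Ker_unitmx MDu.
have KT : Ker T = fullv by rewrite T0 Ker0.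
have newE : new = fullv by rewrite /new KT Img_unitmx_fullv ?capfv.
have oldE : old = 0%VS by rewrite /old KMA KMD addv0.
have [cb _] := hc; have [cP cI] := cb.
have Tr0 f : cusp_form K k m (@Gamma0t F) f -> Tr k m f = (fun=> 0).
  by move=> /cP[v ->]; rewrite hTr -/T T0 mul0mx lincomb0.
have oldformsE := oldforms_fun0 q0 cb Tr0.
have newformsE : newforms K k m = cusp_form K k m (@Gamma0t F).
  apply/seteqP; split=> [f []//|f fG]; split=> //; first exact: Tr0.
  (* The Fricke involution acts by a matrix, so it preserves cusp forms, and [Tr'] is [Tr] of a cusp
     form. *)
  have /cP[v ->] := fG; rewrite /Tr' hFr; apply/Tr0/cP.
  by exists (tC K ^ (m - k%:Z) *: matF (tC K) q j n *m v).
have [r r2] : exists r : K, r ^+ 2 = tC K ^+ k.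
  have /closed_rootP[r] : size ('X^2 - (tC K ^+ k)%:P : {poly K}) != 1%N.
    by rewrite size_XnsubC.
  by rewrite /root !hornerE subr_eq0 => /eqP; exists r.
(* The exponents at [b] and [rev_ord b] add up to [2j + 2 + (n - 1)(q - 1) = k]. *)
have MD2 : (M *m D) *m (M *m D) = (r ^+ 2)%:M.
  rewrite MDE mul_antidiag r2 -diag_const_mx; congr diag_mx; apply/rowP => b.
  rewrite !mxE mulrACA -expr2 sqrr_sign mul1r -exprD; congr (_ ^+ _).
  by rewrite hk /s_exp /=; have := ltn_ord b; nia.
have new_dim : has_dim (newforms K k m) n by exists c; rewrite newformsE.
split; first by rewrite KMA !cap0v.
- split=> [oddq|evenq].
    have rNr : r != - r.
      apply/eqP => rNr; have : r *+ 2 == 0 by rewrite mulr2n {2}rNr subrr.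
      have r0 : r != 0 by have := expf_neq0 k t0; rewrite -r2 expf_eq0.
      rewrite -mulr_natr mulf_eq0 (negPf r0) /= -(dvdn_pcharf pK) dvdn_prime2//.
      by move=> /eqP p2; move: oddq; rewrite hq p2 oddX gtn_eqF.
    by case: (n) (M *m D) MD2 => [|n'] B B2; [exact: diagonalizable_leq1
                                           |exact: diagonalizable_of_sqr B2 rNr].
  have p2 : p = 2%N.
    by case: (even_prime hp) => // oddp; move: evenq; rewrite hq oddX oddp orbT.
  split=> [MDdiag|[d [[c' c'b] d1]]]; last first.
    (* All cusp forms are new, so comparing bases gives [n <= d <= 1]. *)
    apply: diagonalizable_leq1; apply: leq_trans d1.
    by apply: is_basis_leq c'b; rewrite newformsE; exact: cb.
  exists n; split => //; rewrite leqNgt; apply/negP => n1.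
  have := diagonalizable_sqr_pchar2 _ MD2 MDdiag; rewrite -p2 => /(_ pK).
  (* For [n > 1] the bottom left corner is off the diagonal: it is zero in [r%:M] but a signed power
     of [t] in [M D]. *)
  pose b : 'I_n := Ordinal hn; rewrite MDE => /matrixP/(_ (rev_ord b) b)/eqP.
  rewrite !mxE eqxx (_ : (rev_ord b == b) = false) ?mulr0n; last first.
    by rewrite -val_eqE /=; lia.
  by rewrite mulf_eq0 (negPf (signX0 _)) /= expf_eq0 (negPf t0) andbF.
- split.
  + rewrite /is_direct_sum oldformsE newformsE.
    have add0f (h : K -> K) : (fun z => 0 + h z) = h.
      by apply/funext => z; rewrite add0r.
    split; apply/seteqP; split => f /=.
    * by move=> fG; exists (fun=> 0), f; rewrite add0f.
    * by move=> [g [h [-> hG ->]]]; rewrite add0f.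
    * by case.
    * by move=> ->; split=> //; apply/cP; exists 0; rewrite lincomb0.
  + move=> v; rewrite oldE oldformsE memv0; split=> /= [|/eqP->].
      by rewrite -(lincomb0 c) => /cI->.
    exact: lincomb0.
  + by move=> v; rewrite newE newformsE memvf; split=> // _; apply/cP; exists v.
  + by rewrite newE addvf.
  + by rewrite !directv_addE !directv_trivial /= KMA KMD addv0 !cap0v eqxx.
Qed.
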